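(* Let $F=F(a_1,\dots,a_k)$ be a free group of rank $k\ge2$, equipped with the standard word metric corresponding to $\{a_1,\dots,a_k\}$. Then for any $\phi\in Aut(F)$ we have $$flux(\phi)=\begin{cases}0,&\text{if }\phi\text{ is a relabeling automorphism},\\1,&\text{otherwise.}\end{cases}$$
   Context: For a finitely generated group $G$ with a fixed word metric (word length $|\cdot|$) and $\phi\in Aut(G)$, define for each $n\ge0$ $$flux_\phi(n):=\#\{g\in G:|g|\le n,\ |\phi(g)|>n\},\qquad flux(\phi):=\limsup_{n\to\infty}\sqrt[n]{\frac{flux_\phi(n)}{\#\{g\in G:|g|\le n\}}}.$$ An automorphism of $F$ is a relabeling automorphism if it is induced by a permutation of $\{a_1,\dots,a_k\}^{\pm1}$. *)

(* Defs.v *)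
From HB Require Import structures.
From mathcomp Require Import all_boot all_order all_algebra all_fingroup.
From mathcomp Require Import finmap.
From mathcomp Require Import all_classical all_reals all_analysis.

Set Implicit Arguments.
Unset Strict Implicit.
Unset Printing Implicit Defensive.

Import Order.TTheory GRing.Theory Num.Theory.

(* Words over generators; the signed generator (i, false) stands for a_i and
   (i, true) for its inverse. *)

Local Open Scope group_scope.

Section WordMetric.
Variables (I : finType) (G : groupType) (a : I -> G).

Definition letter (x : I * bool) : G := if x.2 then (a x.1)^-1 else a x.1.

Definition word_val (w : seq (I * bool)) : G := \prod_(x <- w) letter x.

Definition generates : Prop := forall g : G, exists w, word_val w = g.

Definition has_word (g : G) (n : nat) : bool :=
  `[< exists2 w, size w = n & word_val w = g >].

Lemma has_word_ex (genG : generates) (g : G) : exists n, has_word g n.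
Proof. by have [w wg] := genG g; exists (size w); apply/asboolP; exists w. Qed.

Definition word_length (genG : generates) (g : G) : nat :=
  ex_minn (has_word_ex genG g).

Definition ball (genG : generates) (n : nat) : set G :=
  [set g | (word_length genG g <= n)%N]%classic.

Definition flux_set (genG : generates) (phi : G -> G) (n : nat) : set G :=
  [set g | (word_length genG g <= n)%N && (n < word_length genG (phi g))%N]%classic.

(* fset_set is junk on infinite sets; the next two lemmas rule this out. *)
Lemma finite_ball genG n : finite_set (ball genG n).
Proof.
pose A m : set G := [set word_val (val t) | t in [set: m.-tuple (I * bool)%type]]%classic.
have fA m : finite_set (A m) by apply: finite_image; exact: finite_finset.
apply: (@sub_finite_set _ _ (\bigcup_(m in `I_n.+1) A m)%classic); last first.
  by apply: bigcup_finite; [exact: finite_II | move=> m _; exact: fA].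
move=> g; rewrite /ball /= /word_length; case: ex_minnP => m.
move=> /asboolP[w szw wg] _ lemn; exists m => //=.
by exists (Tuple (introT eqP szw)).
Qed.

Lemma finite_flux_set genG phi n : finite_set (flux_set genG phi n).
Proof.
by apply: sub_finite_set (finite_ball genG n) => g /= /andP[].
Qed.

Definition flux_count genG (phi : G -> G) (n : nat) : nat :=
  #|` fset_set (flux_set genG phi n) |%fset.

Definition ball_count genG (n : nat) : nat := #|` fset_set (ball genG n) |%fset.

(* The n-th root is the real power with exponent 1 / n; its value at n = 0 is
   irrelevant to the limsup, which is taken in the extended reals. *)
Definition flux (R : realType) genG (phi : G -> G) : \bar R :=
  limn_esup (fun n : nat =>
    (((flux_count genG phi n)%:R / (ball_count genG n)%:R)
       `^ (n%:R^-1))%R%:E).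

End WordMetric.

(* The free group on a type of generators, as the reduced words. *)

Section FreeGroup.
Variable I : choiceType.
Implicit Types (x y : I * bool) (u v w : seq (I * bool)).

Definition linv x : I * bool := (x.1, ~~ x.2).

Definition reduced w : bool := sorted (fun x y => y != linv x) w.

Record free_group := FreeGroup { fg_word :> seq (I * bool); _ : reduced fg_word }.
HB.instance Definition _ := [isSub for fg_word].
HB.instance Definition _ := [Choice of free_group by <:].

(* Left multiplication of a reduced word by one letter. *)
Definition push x w : seq (I * bool) :=
  if w is y :: w' then if y == linv x then w' else x :: w else [:: x].

Lemma linvK : involutive linv.
Proof. by case=> i b; rewrite /linv /= negbK. Qed.

Lemma reduced_behead x w : reduced (x :: w) -> reduced w.
Proof. exact: path_sorted. Qed.

Lemma push_reduced x w : reduced w -> reduced (push x w).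
Proof.
case: w => //= y w; case: ifPn => [_ /path_sorted //|ne /= pw].
by rewrite /reduced /= ne.
Qed.

Lemma pushK x w : reduced w -> push x (push (linv x) w) = w.
Proof.
case: w => [|y w] /=; first by rewrite eqxx.
rewrite linvK; case: (eqVneq y x) => [-> | ne] rw /=; last by rewrite eqxx.
by case: w rw => //= z w /andP[/negPf->].
Qed.

Lemma foldr_push_reduced u w : reduced w -> reduced (foldr push w u).
Proof. by move=> rw; elim: u => //= x u; exact: push_reduced. Qed.

Lemma foldr_push_nil w : reduced w -> foldr push [::] w = w.
Proof.
elim: w => //= x w IH rxw; rewrite IH; last exact: reduced_behead rxw.
by case: w rxw {IH} => //= y w /andP[/negPf->].
Qed.

Lemma foldr_push_push x u w : reduced w ->
  foldr push w (push x u) = push x (foldr push w u).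
Proof.
move=> rw; case: u => //= y u; case: eqP => //= ->.
by rewrite pushK // foldr_push_reduced.
Qed.

Lemma foldr_pushA u v w : reduced w ->
  foldr push w (foldr push v u) = foldr push (foldr push w v) u.
Proof. by move=> rw; elim: u => //= x u IH; rewrite foldr_push_push // IH. Qed.

Definition winv w := rev (map linv w).

Lemma winvK : involutive winv.
Proof. by move=> w; rewrite /winv map_rev revK mapK //; exact: linvK. Qed.

Lemma winv_reduced w : reduced w -> reduced (winv w).
Proof.
rewrite /reduced /winv rev_sorted sorted_map => sw.
apply: sub_sorted sw => x y /= ne; rewrite linvK eq_sym.
by apply: contra ne => /eqP <-.
Qed.

Lemma foldr_push_winv w u : reduced u ->
  foldr push (foldr push u (winv w)) w = u.
Proof.
elim: w u => //= x w IH u ru.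
rewrite /winv /= rev_cons -cats1 foldr_cat /= IH; first exact: pushK.
exact: push_reduced.
Qed.

Definition fg_one := @FreeGroup [::] isT.

Definition fg_mul (u v : free_group) :=
  FreeGroup (foldr_push_reduced u (valP v)).

Definition fg_inv (u : free_group) := FreeGroup (winv_reduced (valP u)).

Fact fg_mulA : associative fg_mul.
Proof. by move=> u v w; apply: val_inj; rewrite /= foldr_pushA //; exact: valP. Qed.

Fact fg_mul1 : left_id fg_one fg_mul.
Proof. by move=> u; apply: val_inj. Qed.

Fact fg_mulr1 : right_id fg_one fg_mul.
Proof. by move=> u; apply: val_inj; apply: foldr_push_nil; exact: valP. Qed.

Fact fg_mulV : right_inverse fg_one fg_inv fg_mul.
Proof.
move=> u; apply: val_inj => /=.
by rewrite -(foldr_push_nil (winv_reduced (valP u))) foldr_push_winv.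
Qed.

Fact fg_mulVl : left_inverse fg_one fg_inv fg_mul.
Proof.
move=> u; rewrite -{2}(_ : fg_inv (fg_inv u) = u) ?fg_mulV //.
by apply: val_inj; exact: winvK.
Qed.

HB.instance Definition _ :=
  isGroup.Build free_group fg_mulA fg_mul1 fg_mulr1 fg_mulVl fg_mulV.

Definition fg_gen (i : I) : free_group := @FreeGroup [:: (i, false)] isT.

End FreeGroup.

Section FreeGroupTheory.
Variable I : finType.
Implicit Types (x : I * bool) (w : seq (I * bool)).

Lemma letter_linv (H : groupType) (f : I -> H) x :
  letter f (linv x) = (letter f x)^-1.
Proof. by case: x => i [] //=; rewrite /letter /= invgK. Qed.

Lemma fg_letterE x : letter (@fg_gen I) x = @FreeGroup I [:: x] isT.
Proof. by case: x => i [] //=; apply: val_inj. Qed.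

Lemma fg_word_val (g : free_group I) : word_val (@fg_gen I) g = g.
Proof.
rewrite /word_val; apply: val_inj; rewrite -[RHS]foldr_push_nil ?(valP g) //=.
elim: (fg_word g) => [|x w IH] /=; first by rewrite big_nil.
by rewrite big_cons -IH fg_letterE.
Qed.

Lemma fg_generates : generates (@fg_gen I).
Proof. by move=> g; exists g; exact: fg_word_val. Qed.

(* The universal property of the free group. *)
Lemma fg_universal (H : groupType) (f : I -> H) :
  exists! h : free_group I -> H,
    {morph h : u v / u * v} /\ forall i, h (fg_gen i) = f i.
Proof.
have pushE x w : word_val f (push x w) = letter f x * word_val f w.
  rewrite /word_val; case: w => [|y w] /=; first by rewrite big_seq1 big_nil mulg1.
  by case: eqP => [->|_]; rewrite !big_cons // letter_linv mulKVg.
exists (fun g => word_val f g); split; first split.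
- move=> u v.
  change (word_val f (foldr (@push I) v u) = word_val f u * word_val f v).
  elim: (fg_word u) => [|x w IH] /=; first by rewrite /word_val big_nil mul1g.
  by rewrite pushE IH /word_val big_cons mulgA.
- by move=> i; rewrite /word_val big_seq1.
move=> h [hM hf]; apply: funext => g; rewrite -[in RHS](fg_word_val g).
have h1 : h 1 = 1 by apply: (mulgI (h 1)); rewrite -hM !mulg1.
have hV u : h u^-1 = (h u)^-1.
  by apply: (mulgI (h u)); rewrite -hM !mulgV.
have hl x : h (letter (@fg_gen I) x) = letter f x.
  by case: x => i []; rewrite /letter /= ?hV hf.
rewrite /word_val; elim: (fg_word g) => [|x w IH]; first by rewrite !big_nil h1.
by rewrite !big_cons hM IH hl.
Qed.

(* phi is induced by a permutation of the 2k letters a_i, a_i^-1 (which are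
   pairwise distinct elements of the free group). *)
Definition relabeling (phi : free_group I -> free_group I) : Prop :=
  exists s : {perm (I * bool)}, forall x,
    phi (letter (@fg_gen I) x) = letter (@fg_gen I) (s x).

End FreeGroupTheory.

(* Main.v *)
Require Import Defs.
From mathcomp Require Import all_boot all_order all_algebra all_fingroup.
From mathcomp Require Import finmap zify lra.
From mathcomp Require Import all_classical all_reals all_analysis.

(** A relabeling preserves word length, so its flux vanishes.  Otherwise some
    letter x has |phi(x)| <> 1, and the ratio flux_phi(n) / #B(n) stays above a
    positive constant for infinitely many n, so that the limsup of its n-th
    roots is 1.  Indeed, as phi is injective,
    #{g : |g| > n, |phi(g)| <= n} <= flux_phi(n), so if the ratios were all
    small from some point on, then most g would satisfy |phi(g)| = |g|.
    Counting reduced words u^-1 x v with |u| = |v| = n, one finds u, v such that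
    phi preserves the lengths of u, x^-1 u, v, x v and u^-1 x v.  Then
    phi(u^-1) and phi(u^-1 x) both lie on the geodesic from 1 to
    phi(u^-1 x v), at distances n and n + 1 from 1, hence |phi(x)| = 1, a
    contradiction. *)

Set Implicit Arguments.
Unset Strict Implicit.
Unset Printing Implicit Defensive.

Import Order.TTheory GRing.Theory Num.Theory.

(** * Identities and inverses under group homomorphisms *)

Section MultiplicativeGroups.
Variables (G H : groupType) (phi : {multiplicative G -> H}).
Local Open Scope group_scope.

Lemma multiplicative1 : phi 1 = 1.
Proof. by apply: (mulgI (phi 1)); rewrite -gmulfM !mulg1. Qed.

Lemma multiplicativeV g : phi g^-1 = (phi g)^-1.
Proof.
by apply: (mulgI (phi g)); rewrite -gmulfM !mulgV multiplicative1.
Qed.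

End MultiplicativeGroups.

(** * Length and enumeration of reduced words *)

Section FreeGroupWords.
Variable I : finType.
Local Notation L := (I * bool)%type.
Local Notation F := (free_group I).
Implicit Types (x y : L) (w : seq L) (f g h : F).
Local Open Scope group_scope.

Lemma fg_word_inj : injective (@fg_word I).
Proof. by move=> g h eq_gh; apply: val_inj. Qed.

Definition fg_of_word w : F := word_val (@fg_gen I) w.

Lemma fg_of_wordK w : reduced w -> fg_word (fg_of_word w) = w.
Proof. by move=> rw; have := fg_word_val (FreeGroup rw); rewrite /fg_of_word /= => ->. Qed.

Lemma fg_of_word_cat w1 w2 :
  fg_of_word (w1 ++ w2) = fg_of_word w1 * fg_of_word w2.
Proof. by rewrite /fg_of_word /word_val big_cat. Qed.

Lemma fg_of_word_cons x w :
  fg_of_word (x :: w) = letter (@fg_gen I) x * fg_of_word w.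
Proof. by rewrite /fg_of_word /word_val big_cons. Qed.

Lemma size_push x w : size (push x w) <= (size w).+1.
Proof. by case: w => //= y w; case: ifP => //= _; lia. Qed.

Lemma size_foldr_push w1 w2 : size (foldr (@push I) w2 w1) <= size w1 + size w2.
Proof.
elim: w1 => //= x w1 IH; apply: leq_trans (size_push _ _) _.
by rewrite addSn ltnS.
Qed.

(** A cancelling [push] shortens the word, so full length leaves no room for any cancellation. *)
Lemma foldr_push_size_eq w1 w2 :
  size (foldr (@push I) w2 w1) = (size w1 + size w2)%N ->
  foldr (@push I) w2 w1 = w1 ++ w2.
Proof.
elim: w1 => //= x w1 IH eq_sz.
have := size_push x (foldr (@push I) w2 w1).
have := size_foldr_push w1 w2.
rewrite eq_sz addSn ltnS => le1 le2.
have eq2 : size (foldr (@push I) w2 w1) = (size w1 + size w2)%N.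
  by apply/eqP; rewrite eqn_leq le1.
move: eq_sz; rewrite (IH eq2) addSn -size_cat; case: (w1 ++ w2) => //= y w3.
by case: ifP => //= _; lia.
Qed.

Lemma size_fg_mul g h : size (g * h) <= size g + size h.
Proof. exact: size_foldr_push. Qed.

Lemma fg_mul_cat g h :
  size (g * h) = (size g + size h)%N -> fg_word (g * h) = g ++ h.
Proof. exact: foldr_push_size_eq. Qed.

Lemma size_fg_inv g : size g^-1 = size g.
Proof. by rewrite /= size_rev size_map. Qed.

Lemma size_letter x : size (letter (@fg_gen I) x) = 1%N.
Proof. by rewrite fg_letterE. Qed.

Lemma size_fg_of_word w : size (fg_of_word w) <= size w.
Proof.
elim: w => [|x w IH]; first by rewrite /fg_of_word /word_val big_nil.
by rewrite fg_of_word_cons (leq_trans (size_fg_mul _ _)) // size_letter.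
Qed.

Lemma fg_size1P g : reflect (exists x, g = letter (@fg_gen I) x) (size g == 1)%N.
Proof.
apply: (iffP idP) => [|[x ->]]; last by rewrite size_letter.
case: g => -[|x [|//]] //= rx _; exists x; rewrite fg_letterE; exact: val_inj.
Qed.

Lemma letter_inj : injective (letter (@fg_gen I)).
Proof. by move=> x y /(congr1 (@fg_word I)); rewrite !fg_letterE => -[]. Qed.

(** Evaluating a word can only cancel letters, so the reduced word is a shortest representative. *)
Lemma word_lengthE g : word_length (@fg_generates I) g = size g.
Proof.
rewrite /word_length; case: ex_minnP => m /asboolP[w <- wg] min_m.
apply/eqP; rewrite eqn_leq min_m; last first.
  by apply/asboolP; exists (fg_word g) => //; exact: fg_word_val.
by rewrite -wg size_fg_of_word.
Qed.

(* In the Cayley tree, f and f g both lie on the geodesic from 1 to f g h. *)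
Lemma size_middle f g h :
  size (f * g) = (size f).+1 ->
  size (f * g * h) = (size f + size (g * h)%g)%N ->
  size (f * g * h) = (size (f * g)%g + size h)%N ->
  size g = 1%N.
Proof.
move=> fg1 fgh1 fgh2; have eq_cat : f ++ (g * h)%g = (f * g)%g ++ h.
  by rewrite -(fg_mul_cat fgh2) -mulgA (@fg_mul_cat f) // mulgA.
(* By [eq_cat], [f] is the prefix of [f * g] that lacks only the last letter. *)
have : exists x, fg_word (f * g) = rcons f x.
  have := congr1 (take (size f)) eq_cat.
  rewrite take_size_cat // takel_cat; last by rewrite fg1.
  case/lastP: (fg_word (f * g)) fg1 => // s x; rewrite size_rcons => -[ssz].
  by rewrite -cats1 takel_cat ?ssz // -ssz take_size => ->; exists x; rewrite cats1.
case=> x fgE; apply/eqP/fg_size1P; exists x; apply: (mulgI f).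
rewrite -[f * g]fg_word_val fgE -cats1 -/(fg_of_word _) fg_of_word_cat.
by rewrite [fg_of_word f]fg_word_val /fg_of_word /word_val big_seq1.
Qed.

(** The letter [x] constrains the first letter of the listed words without belonging to them, so the
    count does not depend on [x]. *)
Fixpoint extensions (n : nat) x : seq (seq L) :=
  if n is m.+1 then
    [seq y :: w | y <- [seq y <- enum {: L} | y != linv x], w <- extensions m y]
  else [:: [::]].

Lemma mem_extensions n x w :
  (w \in extensions n x) =
  (size w == n) && path (fun x y => y != linv x) x w.
Proof.
elim: n x w => [|n IH] x w /=; first by rewrite inE; case: w.
apply/allpairsPdep/idP => [[y [w' []]]|].
  by rewrite mem_filter IH => /andP[ney _] /andP[/eqP<- pw] -> /=; rewrite eqxx ney.
case: w => //= y w /andP[szw /andP[ney pw]]; exists y, w.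
by rewrite mem_filter ney mem_enum IH pw andbT.
Qed.

Lemma extensions_uniq n x : uniq (extensions n x).
Proof.
elim: n x => //= n IH x; apply: allpairs_uniq_dep => //.
  by rewrite filter_uniq // enum_uniq.
by move=> [y1 w1] [y2 w2] _ _ /= [-> ->].
Qed.

Lemma size_extensions n x : size (extensions n x) = ((2 * #|I|).-1 ^ n)%N.
Proof.
elim: n x => //= n IH x; rewrite size_allpairs_dep.
under eq_map do rewrite IH.
rewrite sumnE big_map big_const_seq count_predT iter_addn_0 expnS mulnC.
congr (_ * _)%N; rewrite mulnC -card_bool -card_prod -(cardC1 (linv x)).
by rewrite cardE enumT; congr size; apply: eq_filter.
Qed.
End FreeGroupWords.

(** * Bounding changes of length by the flux *)

Section FluxCounting.
Variable I : finType.
Local Notation L := (I * bool)%type.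
Local Notation F := (free_group I).
Local Notation fg := (@fg_of_word I).
Local Notation q := ((2 * #|I|).-1).
Local Notation balls := (Defs.ball (@fg_generates I)).
Local Notation ball_num := (ball_count (@fg_generates I)).
Local Notation flux_num := (flux_count (@fg_generates I)).

Lemma reduced_words_le n : 2 <= #|I| ->
  exists2 s : seq (seq L), size s <= 2 * q ^ n &
    forall w, reduced w -> size w <= n -> w \in s.
Proof.
move=> I_ge2; elim: n => [|n [s szs s_all]].
  by exists [:: [::]] => // -[].
exists (s ++ [seq x :: w | x <- enum {: L}, w <- extensions n x]).
  rewrite size_cat size_allpairs_dep.
  under eq_map do rewrite size_extensions.
  rewrite sumnE big_map big_const_seq count_predT iter_addn_0 -cardE card_prod.
  (* The new sphere has [(q + 1) * q ^ n] words, and [2 + (q + 1) <= 2 * q] because rank at least 2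
     gives [q >= 3]. *)
  rewrite card_bool expnS; nia.
move=> w rw; rewrite leq_eqVlt ltnS mem_cat => /predU1P[szw|/(s_all _ rw)->//].
apply/orP; right; case: w rw szw => // x w rxw [szw].
apply/allpairsPdep; exists x, w.
by rewrite mem_enum mem_extensions szw eqxx.
Qed.

Lemma mem_ball_fset n (g : F) : (g \in fset_set (balls n)) = (size g <= n).
Proof.
rewrite in_fset_set; last exact: finite_ball.
by apply/idP/idP => [/set_mem|]; rewrite ?inE /Defs.ball /= word_lengthE.
Qed.

Lemma ball_count_le n : 2 <= #|I| -> ball_num n <= 2 * q ^ n.
Proof.
move=> I_ge2; have [s szs s_all] := reduced_words_le n I_ge2.
apply: leq_trans szs; rewrite /ball_count -(size_map (@fg_word I)).
apply: uniq_leq_size; first by rewrite (map_inj_uniq (@fg_word_inj I)) fset_uniq.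
move=> _ /mapP[g + ->]; rewrite mem_ball_fset => szg.
by apply: s_all => //; exact: valP.
Qed.

Variable phi : F -> F.

Lemma flux_countE n :
  flux_num phi n = count (fun g => n < size (phi g)) (fset_set (balls n)).
Proof.
rewrite -size_filter; apply/perm_size/uniq_perm => //.
  by rewrite filter_uniq ?fset_uniq.
move=> g; rewrite mem_filter mem_ball_fset in_fset_set; last exact: finite_flux_set.
by apply/idP/idP => [/set_mem|]; rewrite ?inE /flux_set /= !word_lengthE andbC.
Qed.

Lemma count_stretched n (s : seq F) : uniq s -> all (fun g : F => size g <= n) s ->
  count (fun g => n < size (phi g)) s <= flux_num phi n.
Proof.
move=> us /allP s_le; rewrite flux_countE -!size_filter.
apply: uniq_leq_size; first by rewrite filter_uniq ?fset_uniq.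
by move=> g; rewrite !mem_filter mem_ball_fset => /andP[-> /s_le].
Qed.

Hypothesis phi_inj : injective phi.

(* phi embeds both the n-ball elements staying in the ball and the outer
   elements entering it into the n-ball, so the latter are at most as many as
   the elements leaving the ball. *)
Lemma count_shrunk n (s : seq F) : uniq s -> all (fun g : F => n < size g) s ->
  count (fun g => size (phi g) <= n) s <= flux_num phi n.
Proof.
move=> us /allP s_gt; rewrite flux_countE -!size_filter.
set B : seq F := fset_set (balls n).
pose stay := [seq g <- B | size (phi g) <= n].
have szB : size B = (size stay + size [seq g <- B | n < size (phi g)])%N.
  rewrite !size_filter -(count_predC (fun g => size (phi g) <= n) B).
  by congr (_ + _)%N; apply: eq_count => g /=; rewrite ltnNge.
rewrite -(leq_add2l (size stay)) -szB -size_cat -(size_map phi).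
apply: uniq_leq_size.
  rewrite map_inj_uniq // cat_uniq !filter_uniq ?fset_uniq ?andbT //=.
  apply/hasPn => g; rewrite !mem_filter => /andP[_ /s_gt g_gt].
  by rewrite mem_ball_fset [size g <= n]leqNgt g_gt andbF.
move=> _ /mapP[g + ->]; rewrite mem_ball_fset mem_cat !mem_filter.
by case/orP => /andP[].
Qed.

(** An element of the sphere of radius [m.+1] that changes length either leaves the ball of radius
    [m.+1] or enters that of radius [m]; each case costs one flux term. *)
Lemma count_length_changed m (s : seq (seq L)) : uniq s ->
    all (fun w => reduced w && (size w == m.+1)) s ->
  count (fun w => size (phi (fg w)) != m.+1) s
    <= flux_num phi m.+1 + flux_num phi m.
Proof.
move=> us /allP s_sphere; pose t := map fg s.
have ut : uniq t.
  rewrite map_inj_in_uniq // => v w /s_sphere/andP[rv _] /s_sphere/andP[rw _].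
  by move=> /(congr1 (@fg_word I)); rewrite !fg_of_wordK.
have szt g : g \in t -> size g = m.+1.
  by case/mapP => w /s_sphere/andP[rw /eqP<-] ->; rewrite fg_of_wordK.
apply: leq_trans (leq_add (@count_stretched m.+1 t ut _) (@count_shrunk m t ut _)).
- rewrite !count_map -count_predUI; apply: leq_trans (leq_addr _ _).
  by apply: sub_count => w /=; lia.
- by apply/allP => g /szt->.
- by apply/allP => g /szt->.
Qed.

End FluxCounting.

(** * Words whose length [phi] preserves, and the lower bound on the flux *)

Section LengthDistortion.
Variable I : finType.
Local Notation L := (I * bool)%type.
Local Notation F := (free_group I).
Local Notation fg := (@fg_of_word I).
Local Notation q := ((2 * #|I|).-1).
Local Notation ball_num := (ball_count (@fg_generates I)).
Variable phi : {multiplicative F -> F}.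
Hypothesis phi_inj : injective phi.
Local Notation flux_num := (flux_count (@fg_generates I) phi).
Local Notation plen w := (size (phi (fg w))).

Lemma fg_of_word_winv (w : seq L) : reduced w -> fg (winv w) = ((fg w)^-1)%g.
Proof.
by move=> rw; apply: fg_word_inj; rewrite /= !fg_of_wordK ?winv_reduced.
Qed.

Lemma size1_relabeling :
  (forall x : L, size (phi (letter (@fg_gen I) x)) = 1) -> relabeling phi.
Proof.
move=> phi1.
have /choice[s sE] : forall x, exists y, phi (letter (@fg_gen I) x) = letter (@fg_gen I) y.
  by move=> x; apply/fg_size1P; rewrite phi1.
have s_inj : injective s.
  by move=> x y /(congr1 (letter (@fg_gen I))); rewrite -!sE => /phi_inj/letter_inj.
by exists (perm s_inj) => x; rewrite permE.
Qed.

(** Used at [linv x] for the half [u] and at [x] for the half [v] of the words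
    [winv u ++ x :: v]. *)
Definition isometric_extensions n (x : L) : seq (seq L) :=
  [seq w <- extensions n x | (plen w == n) && (plen (x :: w) == n.+1)].

(** Of the [q ^ m.+1] extensions, those failing the first test lie on the sphere of radius [m.+1];
    those failing the second give words on the sphere of radius [m.+2]. Each sphere contributes two
    flux terms. *)
Lemma isometric_extensions_ge m x :
  q ^ m.+1 <= size (isometric_extensions m.+1 x)
    + (flux_num m.+1 + flux_num m) + (flux_num m.+2 + flux_num m.+1).
Proof.
set n := m.+1; rewrite -(size_extensions n x).
have uX := extensions_uniq n x.
have bad1 : count (fun w => plen w != n) (extensions n x) <= flux_num n + flux_num m.
  apply: count_length_changed => //; apply/allP => w.
  by rewrite mem_extensions => /andP[-> /path_sorted rw]; rewrite andbT.
have bad2 : count (fun w => plen (x :: w) != n.+1) (extensions n x)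
    <= flux_num n.+1 + flux_num n.
  rewrite -[X in X <= _](count_map (cons x) (fun w => plen w != n.+1)).
  apply: count_length_changed => //; first by rewrite map_inj_uniq // => v w [].
  apply/allP => _ /mapP[w + ->]; rewrite mem_extensions => /andP[/eqP szw rw].
  by apply/andP; split=> //=; rewrite szw.
apply: leq_trans (leq_add (leq_add (leqnn _) bad1) bad2).
rewrite size_filter -addnA -count_predUI 
  -(count_predC (fun w => (plen w == n) && (plen (x :: w) == n.+1))).
rewrite leq_add2l; apply: leq_trans (leq_addr _ _).
by apply: sub_count => w /=; rewrite negb_and.
Qed.

(** Distinct pairs give distinct words of length [2 * n + 1], and by [size_middle] none of them
    keeps its length under [phi]. *)
Lemma size_isometric_pairs n (x : L) : size (phi (letter (@fg_gen I) x)) != 1 ->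
  size (isometric_extensions n (linv x)) * size (isometric_extensions n x)
    <= flux_num (2 * n).+1 + flux_num (2 * n).
Proof.
move=> phix; set U := isometric_extensions _ _; set V := isometric_extensions _ _.
have UP u : u \in U -> [/\ path (fun x y => y != linv x) (linv x) u, size u = n,
    plen u = n & plen (linv x :: u) = n.+1].
  by rewrite mem_filter mem_extensions => /andP[/andP[/eqP-> /eqP->] /andP[/eqP-> ->]].
have VP v : v \in V -> [/\ path (fun x y => y != linv x) x v, size v = n,
    plen v = n & plen (x :: v) = n.+1].
  by rewrite mem_filter mem_extensions => /andP[/andP[/eqP-> /eqP->] /andP[/eqP-> ->]].
pose W := [seq winv u ++ x :: v | u <- U, v <- V].
rewrite -(size_allpairs (fun u v => winv u ++ x :: v) U V) -/W.
have WP w : w \in W -> [/\ reduced w, size w = (2 * n).+1 & plen w != (2 * n).+1].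
  case/allpairsP => -[u v] /= [/UP[pu szu lu lxu] /VP[pv szv lv lxv] ->].
  have szw : size (winv u ++ x :: v) = (2 * n).+1.
    by rewrite size_cat size_rev size_map /= szu szv; lia.
  have rw : reduced (winv u ++ x :: v).
    (* This inverse is [winv u] followed by [x], and [v] may follow [x]. *)
    have : reduced (winv (linv x :: u)) by apply: winv_reduced.
    rewrite /winv /= rev_cons linvK -cat_rcons.
    case: (rev _) => [|y s] //=.
    by rewrite /reduced /= cat_path last_rcons => ->.
  split=> //; apply: contra phix => /eqP; rewrite fg_of_word_cat fg_of_word_cons.
  rewrite fg_of_word_winv; last exact: path_sorted pu.
  rewrite !gmulfM multiplicativeV mulgA => lw.
  move: lxu lxv; rewrite !fg_of_word_cons !gmulfM letter_linv multiplicativeV => lxu lxv.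
  have lux : size ((phi (fg u))^-1 * phi (letter (@fg_gen I) x))%g = n.+1.
    by rewrite -lxu -size_fg_inv invgM invgK.
  apply/eqP/(@size_middle _ (phi (fg u))^-1%g _ (phi (fg v))).
  - by rewrite lux size_fg_inv lu.
  - by rewrite lw size_fg_inv lu lxv; lia.
  - by rewrite lw lux lv; lia.
have uW : uniq W.
  apply: allpairs_uniq; rewrite ?filter_uniq ?extensions_uniq //.
  move=> [u v] [u' v'] /allpairsP[[a b] /= [/UP[_ sza _ _] _ [-> ->]]].
  case/allpairsP=> [[a' b'] /= [/UP[_ sza' _ _] _ [-> ->]]] /eqP.
  rewrite eqseq_cat ?size_rev ?size_map ?sza ?sza' // => /andP[/eqP eqw /eqP[->]].
  by rewrite (can_inj (@winvK I) eqw).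
rewrite -(count_predT W) -(@eq_in_count _ (fun w => plen w != (2 * n).+1)).
  by apply: count_length_changed => //; apply/allP => w /WP[-> ->]; rewrite eqxx.
by move=> w /WP[_ _ ->].
Qed.

Lemma flux_frequently_large n : 2 <= #|I| -> ~ relabeling phi ->
  exists2 m, n <= m & ball_num m < 16 * q.+1 * flux_num m.
Proof.
move=> I_ge2 nrel.
have [x phix] : exists x : L, size (phi (letter (@fg_gen I) x)) != 1.
  apply: contrapT => all1; apply: nrel; apply: size1_relabeling => x.
  by apply/eqP; apply: contrapT => /negP phix; apply: all1; exists x.
apply: contrapT => small.
(* The bound [2 * q ^ m] on the ball halves the constant 16. *)
have fluxN m : n <= m -> 8 * q.+1 * flux_num m <= q ^ m.
  move=> le_nm; rewrite leqNgt; apply/negP => lt_m; apply: small; exists m => //.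
  by apply: leq_ltn_trans (ball_count_le _ I_ge2) _; lia.
have := size_isometric_pairs n.+1 phix.
set N := q ^ n.+1; set U := size _; set V := size _; set S := _ + _ => leUV.
have N_gt0 : 0 < N by rewrite expn_gt0; lia.
(* The four flux terms sum to at most [(1 + q)^2 * q^n / (8 * (q + 1)) = (q + 1) * q^n / 8], which
   is below [N / 2]. *)
have half m : N <= m + (flux_num n.+1 + flux_num n) + (flux_num n.+2 + flux_num n.+1) ->
    N <= 2 * m.
  have := fluxN n (leqnn n); have := fluxN n.+1 (leqnSn n).
  have := fluxN n.+2 (ltac:(lia)).
  have : q ^ n <= N by rewrite leq_exp2l; lia.
  rewrite expnS -/N.
  move: (flux_num n) (flux_num n.+1) (flux_num n.+2) => f0 f1 f2.
  nia.
have leU : N <= 2 * U by apply: half; apply: isometric_extensions_ge.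
have leV : N <= 2 * V by apply: half; apply: isometric_extensions_ge.
have leS : 8 * S <= N * N.
  have := fluxN (2 * n.+1).+1 (ltac:(lia)); have := fluxN (2 * n.+1) (ltac:(lia)).
  rewrite [q ^ _.+1]expnS (_ : q ^ (2 * n.+1) = N * N); last first.
    by rewrite [2 * n.+1]mul2n -addnn expnD.
  rewrite /S; move: (flux_num _) (flux_num _) => f0 f1; nia.
(* Now [N^2 / 4 <= U * V <= S <= N^2 / 8], against [N > 0]. *)
have := leq_mul leU leV; nia.
Qed.
End LengthDistortion.

(** * Upper limits of n-th roots *)

Section LimsupRoots.
Variable R : realType.
Local Open Scope ring_scope.
Local Open Scope classical_set_scope.

Lemma limn_esup_root0 (r : nat -> R) : (forall n, r n = 0) ->
  limn_esup (fun n => (r n `^ n%:R^-1)%:E) = 0%E.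
Proof.
move=> r0; suff /cvg_limn_einf_sup[_ ->//] :
  (r n `^ n%:R^-1)%:E @[n --> \oo] --> (0 : R)%:E.
(* The sequence is only eventually constant: at [n = 0] the exponent is 0 and the power is 1. *)
apply: cvg_near_cst; near=> n.
by rewrite r0 powR0 // invr_eq0 pnatr_eq0 -lt0n; near: n; exact: nbhs_infty_gt.
Unshelve. all: by end_near. Qed.

(** Roots of numbers in [0, 1] stay at most 1; conversely, for any [t < 1] the powers [t ^+ m] drop
    below [c], so the m-th root of [r m] exceeds [t] infinitely often. *)
Lemma limn_esup_root1 (r : nat -> R) (c : R) : (forall n, 0 <= r n <= 1) ->
    0 < c -> (forall n, exists2 m, (n <= m)%N & c <= r m) ->
  limn_esup (fun n => (r n `^ n%:R^-1)%:E) = 1%E.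
Proof.
move=> r01 c_gt0 c_le_r; apply/eqP; rewrite eq_le; apply/andP; split.
  apply: ge_ereal_inf; exists (ereal_sup (range (fun n => (r n `^ n%:R^-1)%:E))).
    by exists setT => //; exact: filterT.
  apply: ge_ereal_sup => _ [n _ <-]; have /andP[r_ge0 r_le1] := r01 n.
  rewrite lee_fin [leRHS](_ : 1 = 1 `^ n%:R^-1); last by rewrite powR1.
  by apply: ge0_ler_powR; rewrite ?nnegrE ?invr_ge0.
apply: le_ereal_inf_tmp => _ [V [N _ NV] <-].
(* The maximum keeps [t] nonnegative when [e > 1]. *)
apply/lee_subgt0Pr => e e_gt0; pose t : R := Num.max 0 (1 - e).
have t_ge0 : 0 <= t by rewrite le_max lexx.
have t_lt1 : `|t| < 1 by rewrite ger0_norm // gt_max ltr01; lra.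
have [M _ Mt] : \forall n \near \oo, t ^+ n < c.
  exact: (cvgr_lt 0 (cvg_expr t_lt1)).
(* Here [M] makes [t ^+ m < c], [N] puts [m] in the neighbourhood [V], and 1 makes the m-th root
   genuine. *)
have [m le_m c_le] := c_le_r (maxn M (maxn N 1)).
apply: le_ereal_sup_tmp; exists (r m `^ m%:R^-1)%:E.
  by exists m => //; apply: NV => /=; lia.
rewrite -EFinB lee_fin; apply: (@le_trans _ _ t); first by rewrite le_max lexx orbT.
have m_gt0 : (0 < m)%N by lia.
have tE : t = (t ^+ m) `^ m%:R^-1.
  by rewrite -powR_mulrn // -powRrM divff ?powRr1 // pnatr_eq0 -lt0n.
have /andP[r_ge0 _] := r01 m.
rewrite tE; apply: ge0_ler_powR; rewrite ?nnegrE ?invr_ge0 ?exprn_ge0 //.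
apply: le_trans c_le; apply: ltW.
by apply: Mt => /=; lia.
Qed.

End LimsupRoots.

Theorem corollary9 (R : realType) (k : nat) (k_ge2 : (2 <= k)%N)
    (phi : {multiplicative (free_group 'I_k) -> (free_group 'I_k)})
    (phi_bij : bijective phi) :
  flux R (@fg_generates 'I_k) phi = (if `[< relabeling phi >] then 0 else 1)%E.
Proof.
have phi_inj := bij_inj phi_bij.
rewrite /flux; case: asboolP => [[s sE]|nrel].
  apply: limn_esup_root0 => n; rewrite flux_countE (@eq_in_count _ _ pred0).
    by rewrite count_pred0 mul0r.
  move=> g; rewrite mem_ball_fset => g_le /=; apply/negbTE; rewrite -leqNgt.
  (* A relabeling sends a word to a product of equally many letters, so no element leaves the
     ball. *)
  apply: leq_trans g_le; rewrite -[g in phi g]fg_word_val.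
  elim: (fg_word g) => [|x w IH].
    by rewrite /word_val big_nil multiplicative1.
  rewrite /word_val big_cons gmulfM sE (leq_trans (size_fg_mul _ _)) //.
  by rewrite size_letter ltnS.
have ball_gt0 n : 0 < ball_count (@fg_generates 'I_k) n.
  rewrite cardfs_gt0; apply/fset0Pn; exists 1%g; by rewrite mem_ball_fset.
apply: (@limn_esup_root1 _ _ (16 * (2 * #|'I_k|).-1.+1)%:R^-1).
- move=> n; rewrite divr_ge0 //= ler_pdivrMr ?ltr0n // mul1r ler_nat.
  rewrite flux_countE; exact: count_size.
- by rewrite invr_gt0 ltr0n.
move=> n; have [||m le_nm lt_m] := @flux_frequently_large _ phi phi_inj n.
- by rewrite card_ord.
- by [].
exists m => //; rewrite ler_pdivlMr ?ltr0n // mulrC ler_pdivrMr ?ltr0n //.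
by rewrite -natrM ler_nat mulnC ltnW.
Qed.
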